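(* Let $X$ be a Banach space with a normalized monotone basis, let $\sigma$ be any subset of $\Sigma_f(X)$ and let $\Delta=(\delta_1,\delta_2,\dots)$ be a sequence of positive real numbers. Then $X$ has a block subspace $Y$ such that either no element of $\sigma$ has all its terms in $Y$, or player P has a winning strategy for the game $\sigma_\Delta[Y]$.
   Context: Banach spaces and subspaces are infinite-dimensional. $X$ comes with a fixed basis $(e_n)_{n=1}^\infty$ with $\|e_n\|=1$, which is monotone (all projections $\sum_{n=1}^\infty a_ne_n\mapsto\sum_{n=1}^N a_ne_n$ have norm at most $1$). The support of $x=\sum x_ne_n$ is $\{n:x_n\neq0\}$; $x<y$ means $\max\operatorname{supp}(x)<\min\operatorname{supp}(y)$. A block basis is a sequence $x_1<x_2<\cdots$ of nonzero (finitely supported) vectors; a block subspace is the closed linear span of an infinite block basis. $\Sigma_f(X)$ is the set of all finite sequences $(x_1,\dots,x_n)$ of nonzero finitely supported vectors in the unit ball of $X$ with $x_1<\cdots<x_n$. For $\sigma\subset\Sigma_f(X)$, $\sigma_\Delta$ is the set of $(x_1,\dots,x_n)\in\Sigma_f(X)$ such that there is $(y_1,\dots,y_n)\in\sigma$ with $\|y_i-x_i\|\le\delta_i$ for every $i$. For $\tau\subset\Sigma_f(X)$ and a block subspace $Y$, the game $\tau[Y]$ is played by S and P: on the $n$th move S chooses a block subspace $X_n\subset Y$ and then P chooses a vector $x_n\in X_n$. P's aim is that at some stage $n$ the sequence $(x_1,\dots,x_n)$ belongs to $\tau$; S's aim is that this never happens. A strategy for P is a function $\phi$ assigning to each finite sequence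 $x_1,\dots,x_n$ ($n\ge0$) and block subspace $Z\subset Y$ a vector $\phi(x_1,\dots,x_n;Z)\in Z$; it is winning if for every sequence $X_1,X_2,\dots$ of block subspaces of $Y$ the sequence defined by $x_{n+1}=\phi(x_1,\dots,x_n;X_{n+1})$ has some finite initial segment in $\tau$. *)

(* Defs.v *)
From mathcomp Require Export all_boot all_order all_algebra.
From mathcomp Require Export all_classical all_reals all_analysis.
From mathcomp Require Export complex.
Export Order.TTheory GRing.Theory Num.Theory.
Export numFieldNormedType.Exports.

Set Implicit Arguments.
Unset Strict Implicit.
Unset Printing Implicit Defensive.

Local Open Scope classical_set_scope.
Local Open Scope ring_scope.

(* For a normed space over a numFieldType K the norm takes its values in K, and
   0 < d in K = R[i] means that d is a positive real number. *)

Section Basis.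
Variables (K : numFieldType) (X : normedModType K).
Implicit Types (e x : nat -> X) (a : nat -> K) (v w : X) (Y Z : set X).

Definition expansion e v a : Prop :=
  series (fun n => a n *: e n) @ \oo --> v.

Definition is_basis e : Prop := forall v, exists! a, expansion e v a.

(* Meaningful when e is a basis: the coefficients are then unique. *)
Definition coords e v : nat -> K :=
  xget (fun=> 0) [set a | expansion e v a].

Definition monotone_basis e : Prop :=
  forall v N, `|\sum_(n < N) coords e v n *: e n| <= `|v|.

Definition supp e v : set nat := [set n | coords e v n != 0].

Definition finitely_supported e v : Prop := finite_set (supp e v).

(* max (supp v) < min (supp w), for nonzero finitely supported v and w *)
Definition precedes e v w : Prop :=
  forall m n, supp e v m -> supp e w n -> (m < n)%N.

Definition block_basis e x : Prop :=
  forall n, [/\ x n != 0, finitely_supported e (x n)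
              & precedes e (x n) (x n.+1)].

Definition linear_span x : set X :=
  [set v | exists N a, v = \sum_(n < N) a n *: x n].

Definition block_subspace e Y : Prop :=
  exists2 x, block_basis e x & Y = closure (linear_span x).

(* The empty sequence is allowed. *)
Definition Sigma_f e : set (seq X) :=
  [set s | (forall i, (i < size s)%N ->
              [/\ s`_i != 0, finitely_supported e s`_i & `|s`_i| <= 1])
         /\ (forall i, (i.+1 < size s)%N -> precedes e s`_i s`_i.+1)].

(* Indices start at 0: delta 0 bounds the distance between the first terms. *)
Definition enlargement e (sigma : set (seq X)) (delta : nat -> K) :
    set (seq X) :=
  [set s | Sigma_f e s /\
     exists t, [/\ sigma t, size t = size s
       & forall i, (i < size s)%N -> `|t`_i - s`_i| <= delta i]].

Definition is_strategy e Y (phi : seq X -> set X -> X) : Prop :=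
  forall s Z, block_subspace e Z -> Z `<=` Y -> Z (phi s Z).

(* P's first n vectors when S plays Zs 0, Zs 1, ... and P follows phi *)
Fixpoint play (phi : seq X -> set X -> X) (Zs : nat -> set X) (n : nat) :
    seq X :=
  if n is m.+1 then rcons (play phi Zs m) (phi (play phi Zs m) (Zs m))
  else [::].

Definition winning_strategy e (tau : set (seq X)) Y
    (phi : seq X -> set X -> X) : Prop :=
  is_strategy e Y phi /\
  forall Zs : nat -> set X,
    (forall n, block_subspace e (Zs n) /\ Zs n `<=` Y) ->
    exists n, tau (play phi Zs n).

End Basis.

(* Main.v *)
(* A rounding map r : X -> nat replaces an admissible vector by a code which
   determines its support and, up to the required precision, the vector itself,
   in such a way that only finitely many codes occur below each N. The state of
   the game is the sequence s of codes of the vectors played so far, and T is the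
   set of codes of sequences in sigma. If every subspace of Y contains a vector x
   such that P wins on Y from s followed by the code of x, then P wins on Y from
   s. There are countably many states, so a diagonal argument gives Y such that,
   for each s, either P wins on Y from s or P wins from s on no subspace of Y. If
   P does not win from the empty state, a second diagonal argument, which uses
   that finitely many states occur below each N, gives a block subspace of Y in
   which every admissible continuation of a lost state is again lost. A sequence
   of sigma inside that subspace would be a target reached through lost states
   only. *)

Require Import Defs.
From mathcomp Require Import lra.

Set Implicit Arguments.
Unset Strict Implicit.
Unset Printing Implicit Defensive.

Local Open Scope classical_set_scope.
Local Open Scope ring_scope.

(** * Coordinates and partial-sum projections of a basis *)

Section Coordinates.
Variables (K : numFieldType) (X : normedModType K) (e : nat -> X).
Hypothesis basis_e : is_basis e.
Implicit Types (v w : X) (a : nat -> K).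

Lemma expansion_coords v : expansion e v (coords e v).
Proof. by apply: xgetPex; have [a [ha _]] := basis_e v; exists a. Qed.

Lemma expansion_uniq v a : expansion e v a -> coords e v = a.
Proof.
move=> va; have [b [_ hb]] := basis_e v.
by rewrite -(hb _ va) (hb _ (@expansion_coords v)).
Qed.

Lemma coordsP (a : K) v w n : coords e (a *: v + w) n = a * coords e v n + coords e w n.
Proof.
have -> : coords e (a *: v + w) = fun n => a * coords e v n + coords e w n.
  apply: expansion_uniq; rewrite /expansion.
  have -> : series (fun n => (a * coords e v n + coords e w n) *: e n) =
     (fun n => a *: series (fun n => coords e v n *: e n) n +
               series (fun n => coords e w n *: e n) n).
    apply/funext => m; rewrite /series /= scaler_sumr -big_split /=.
    by apply: eq_bigr => i _; rewrite scalerDl scalerA.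
  by apply: cvgD; [apply: cvgZr|]; exact: expansion_coords.
by [].
Qed.

Lemma coords0 n : coords e 0 n = 0.
Proof.
by have := coordsP (-1) 0 0 n; rewrite scaler0 addr0 mulN1r addNr.
Qed.

Lemma coordsD v w n : coords e (v + w) n = coords e v n + coords e w n.
Proof. by have := coordsP 1 v w n; rewrite scale1r mul1r. Qed.

Lemma coordsZ (a : K) v n : coords e (a *: v) n = a * coords e v n.
Proof. by have := coordsP a v 0 n; rewrite addr0 coords0 addr0. Qed.

Lemma coordsB v w n : coords e (v - w) n = coords e v n - coords e w n.
Proof. by rewrite coordsD -scaleN1r coordsZ mulN1r. Qed.

Lemma coords_sum (I : Type) (s : seq I) (P : pred I) (F : I -> X) n :
  coords e (\sum_(i <- s | P i) F i) n = \sum_(i <- s | P i) coords e (F i) n.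
Proof.
elim/big_rec2: _ => [|i x y _ <-]; first exact: coords0.
by rewrite coordsD.
Qed.

Lemma coords_basis m n : coords e (e m) n = (m == n)%:R.
Proof.
have -> : coords e (e m) = fun n => (m == n)%:R; last by [].
apply: expansion_uniq; rewrite /expansion; apply: cvg_near_cst.
exists m.+1 => // k /= mk; rewrite /series /=.
rewrite (bigD1_seq m) ?mem_index_iota ?iota_uniq //= eqxx scale1r.
by rewrite big1 ?addr0 // => i /negPf im; rewrite eq_sym im scale0r.
Qed.

Definition proj N v : X := \sum_(n < N) coords e v n *: e n.

Lemma projP N (a : K) v w : proj N (a *: v + w) = a *: proj N v + proj N w.
Proof.
rewrite /proj scaler_sumr -big_split /=.
by apply: eq_bigr => i _; rewrite coordsP scalerDl scalerA.
Qed.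

Lemma projB N v w : proj N (v - w) = proj N v - proj N w.
Proof. by rewrite addrC -scaleN1r projP scaleN1r addrC. Qed.

Lemma proj_id N v : (forall n, (N <= n)%N -> coords e v n = 0) -> proj N v = v.
Proof.
move=> vN; have := @expansion_coords v; rewrite /expansion => vE.
apply: (cvg_unique (@norm_hausdorff _ _) _ vE); apply: cvg_near_cst.
exists N => // k /= Nk; rewrite /series /= (big_cat_nat (n := N)) //=.
rewrite [X in _ + X = _]big_nat [X in _ + X = _]big1 ?addr0 ?big_mkord //.
by move=> i /andP[Ni _]; rewrite vN // scale0r.
Qed.

Lemma proj0 N v : (forall n, (n < N)%N -> coords e v n = 0) -> proj N v = 0.
Proof. by move=> vN; rewrite /proj big1 // => i _; rewrite vN // scale0r. Qed.

Lemma coords_inj v w : coords e v =1 coords e w -> v = w.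
Proof.
move=> vw; apply/eqP; rewrite -subr_eq0; apply/eqP.
rewrite -(@proj_id 0 (v - w)) ?[LHS]big_ord0 // => n _.
by rewrite coordsB vw subrr.
Qed.

Lemma supp_neq0 v : v != 0 -> exists n, coords e v n != 0.
Proof.
move=> v0; apply: contrapT => /forallNP h; move/eqP: v0; apply.
by apply: coords_inj => n; rewrite coords0; apply: contrapT => /eqP /h.
Qed.

Hypothesis normalized_e : forall n, `|e n| = 1.
Hypothesis monotone_e : monotone_basis e.

(** The n-th term of the expansion is the difference of two consecutive partial sums, each of norm
    at most [|v|]; hence the factor 2. *)
Lemma coords_bound v n : `|coords e v n| <= 2 * `|v|.
Proof.
have -> : `|coords e v n| = `|proj n.+1 v - proj n v|.
  by rewrite /proj big_ord_recr /= addrAC subrr add0r normrZ normalized_e mulr1.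
rewrite (le_trans (ler_normB _ _)) // mulr2n mulrDl mul1r lerD //; exact: monotone_e.
Qed.

Lemma proj_continuous N : continuous (proj N).
Proof.
move=> v; apply/cvgrPdist_lt => eps eps0.
near=> w; rewrite -projB; apply: le_lt_trans (monotone_e _ _) _.
by near: w; apply: cvgr_dist_lt.
Unshelve. all: by end_near. Qed.

Lemma coords_continuous n : continuous (fun v => coords e v n : K^o).
Proof.
move=> v; apply/cvgrPdist_lt => eps eps0.
near=> w; rewrite -coordsB; apply: le_lt_trans (coords_bound _ _) _.
rewrite mulrC -ltr_pdivlMr //.
by near: w; apply: cvgr_dist_lt => //; rewrite divr_gt0.
Unshelve. all: by end_near. Qed.

End Coordinates.

(** * Closed linear spans *)

Section Spans.
Variables (K : numFieldType) (X : normedModType K).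
Implicit Types (x y : nat -> X) (v w : X).

Definition clspan x : set X := closure (linear_span x).

Lemma linear_span_basis x n : linear_span x (x n).
Proof.
exists n.+1, (fun m => (m == n)%:R); rewrite big_ord_recr /= eqxx scale1r.
rewrite big1 ?add0r // => i _.
by rewrite (ltn_eqF (ltn_ord i)) scale0r.
Qed.

Lemma linear_spanP x (a : K) v w :
  linear_span x v -> linear_span x w -> linear_span x (a *: v + w).
Proof.
have widen M N (c : nat -> K) : \sum_(n < N) c n *: x n =
    \sum_(n < maxn M N) (if (n < N)%N then c n else 0) *: x n.
  rewrite (big_ord_widen (maxn M N) (fun n => c n *: x n)) ?leq_maxr //.
  rewrite big_mkcond /=; apply: eq_bigr => i _.
  by case: ifP => // _; rewrite scale0r.
move=> [M [b ->]] [N [c ->]].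
exists (maxn M N), (fun n => a * (if (n < M)%N then b n else 0) +
                      (if (n < N)%N then c n else 0)).
rewrite (widen M N) (widen N M) (maxnC N M) scaler_sumr -big_split /=.
by apply: eq_bigr => i _; rewrite scalerDl scalerA.
Qed.

(** The preimage of [closure B] is closed and contains [A]. This reduces statements about closed
    spans to finite linear combinations. *)
Lemma closure_map (f : X -> X) (A B : set X) : continuous f ->
  (forall v, A v -> closure B (f v)) -> forall v, closure A v -> closure B (f v).
Proof.
move=> cf AB v Av.
have : closed (f @^-1` closure B).
  by apply: closed_comp => [u _|]; [exact: cf|exact: closed_closure].
move=> /closure_id fBE; have : closure (f @^-1` closure B) v by exact: closureS Av.
by rewrite -fBE.
Qed.

Lemma clspanP x (a : K) v w : clspan x v -> clspan x w -> clspan x (a *: v + w).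
Proof.
move=> xv xw.
apply: (@closure_map (fun u => a *: u + w) (linear_span x)) => //.
  by move=> u; apply: cvgD; [apply: cvgZr; exact: cvg_id|exact: cvg_cst].
move=> u xu; apply: (@closure_map (fun w => a *: u + w) (linear_span x)) => //.
  by move=> u'; apply: cvgD; [exact: cvg_cst|exact: cvg_id].
by move=> w' xw'; apply: subset_closure; exact: linear_spanP.
Qed.

Lemma clspan_basis x n : clspan x (x n).
Proof. by apply: subset_closure; exact: linear_span_basis. Qed.

Lemma clspan0 x : clspan x 0.
Proof.
by apply: subset_closure; exists 0%N, (fun=> 0); rewrite big_ord0.
Qed.

Lemma clspan_subset x y : (forall n, clspan x (y n)) -> clspan y `<=` clspan x.
Proof.
move=> xy v yv; apply: (@closure_map idfun (linear_span y)) => //.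
  by move=> u; exact: cvg_id.
move=> _ [N [a ->]] /=; elim: N => [|N IH]; first by rewrite big_ord0; exact: clspan0.
by rewrite big_ord_recr /= addrC; exact: clspanP.
Qed.

End Spans.

(** * Block bases and their tails *)

Section Blocks.
Variables (K : numFieldType) (X : normedModType K) (e : nat -> X).
Implicit Types (x y : nat -> X) (v w : X) (Y Z : set X) (N : nat -> nat).

Lemma finitely_supportedP v : finitely_supported e v <->
  exists M : nat, forall n, coords e v n != 0 -> (n < M)%N.
Proof.
split=> [/finite_seqP[s sE]|[M vM]].
  exists (\max_(i <- s) i).+1 => n vn; rewrite ltnS.
  apply: leq_bigmax_seq => //.
  by have : supp e v n by []; rewrite sE.
by apply: sub_finite_set (finite_II M) => n /vM.
Qed.

Hypothesis basis_e : is_basis e.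

Lemma block_basis_supp x k n :
  block_basis e x -> coords e (x k) n != 0 -> (k <= n)%N.
Proof.
move=> bx; elim: k n => // k IH n xn.
have [xk0 _ xkx] := bx k.
have [m xm] := supp_neq0 basis_e xk0.
exact: leq_ltn_trans (IH _ xm) (xkx _ _ xm xn).
Qed.

Lemma block_basis_tail x k : block_basis e x -> block_basis e (fun n => x (k + n)%N).
Proof. by move=> bx n; have := bx (k + n)%N; rewrite addnS. Qed.

Lemma block_subspace_clspan x : block_basis e x -> block_subspace e (clspan x).
Proof. by exists x. Qed.

Lemma block_subspace0 Y : block_subspace e Y -> Y 0.
Proof. by case=> x _ ->; exact: clspan0. Qed.

Lemma block_basis_e : block_basis e e.
Proof.
move=> n; have eE := coords_basis basis_e; split.
- apply: contraTneq (oner_neq0 K) => en0.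
  by rewrite negbK -(coords0 basis_e n) -en0 eE eqxx.
- apply/finitely_supportedP; exists n.+1 => m; rewrite eE.
  by case: (eqVneq n m) => [->//|_]; rewrite eqxx.
- move=> i j; rewrite /supp /= !eE.
  by case: (eqVneq n i) => [<-|_]; case: (eqVneq n.+1 j) => [<-|_]; rewrite ?eqxx.
Qed.

(** The marks [N k] cut the coordinates from [N 0] on into consecutive intervals without gaps, one
    for each vector of the block basis. *)
Definition blocks y N := forall k,
  [/\ y k != 0, (N k < N k.+1)%N
    & forall n, coords e (y k) n != 0 -> (N k <= n < N k.+1)%N].

Section BlocksTheory.
Variables (y : nat -> X) (N : nat -> nat).
Hypothesis yN : blocks y N.

Lemma blocks_ltn k l : (k < l)%N -> (N k < N l)%N.
Proof.
move=> kl; apply: (@homo_ltn _ N (fun i j => i < j)%N) kl => [a b c|i].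
  exact: ltn_trans.
by case: (yN i).
Qed.

Lemma blocks_leq k l : (k <= l)%N -> (N k <= N l)%N.
Proof.
rewrite leq_eqVlt => /predU1P[->//|kl]; exact/ltnW/blocks_ltn.
Qed.

Lemma blocks_ge k : (k <= N k)%N.
Proof. by elim: k => // k IH; apply: leq_ltn_trans IH _; exact: blocks_ltn. Qed.

Lemma block_basis_blocks : block_basis e y.
Proof.
move=> k; have [yk0 _ yk] := yN k; have [_ _ yk1] := yN k.+1; split=> //.
  by apply/finitely_supportedP; exists (N k.+1) => n /yk /andP[].
move=> m n /yk /andP[_ mk] /yk1 /andP[kn _]; exact: leq_trans mk kn.
Qed.

Lemma blocks_coord_eq0 k n l : (N k <= n < N k.+1)%N -> l != k ->
  coords e (y l) n = 0.
Proof.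
move=> /andP[kn nk] lk; apply: contraTeq lk => /(let: And3 _ _ h := yN l in h n).
move=> /andP[ln nl]; rewrite negbK eqn_leq.
have -> : (l <= k)%N.
  by rewrite leqNgt; apply/negP => /blocks_leq; rewrite leqNgt (leq_ltn_trans ln).
by rewrite leqNgt; apply/negP => /blocks_leq; rewrite leqNgt (leq_ltn_trans kn).
Qed.

Hypothesis normalized_e : forall n, `|e n| = 1.
Hypothesis monotone_e : monotone_basis e.

(* On the k-th block, v is a multiple of y k; cross-multiplying avoids naming
   the factor and gives a closed condition. *)
Lemma clspan_blocks_coords v k m n : clspan y v ->
  (N k <= m < N k.+1)%N -> (N k <= n < N k.+1)%N ->
  coords e v m * coords e (y k) n = coords e v n * coords e (y k) m.
Proof.
move=> yv mk nk.
pose f u : K^o := coords e u m * coords e (y k) n - coords e u n * coords e (y k) m.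
have cf : continuous f.
  move=> u; apply: cvgB; apply: cvgM; try exact: cvg_cst; exact: coords_continuous.
have : closed (f @^-1` [set 0]).
  apply: closed_comp => [u _|]; first exact: cf.
  exact/accessible_closed_set1/hausdorff_accessible/norm_hausdorff.
move=> /closure_id fE; apply/eqP; rewrite -subr_eq0; apply/eqP.
rewrite -/(f v) -[f v = 0]/((f @^-1` [set 0]) v) fE.
apply: closureS yv => _ [M [a ->]] /=.
rewrite /f !(coords_sum basis_e) !mulr_suml -sumrB big1 // => i _.
rewrite !(coordsZ basis_e); have [->|ik] := eqVneq (i : nat) k.
  by rewrite -!mulrA [X in _ * X]mulrC subrr.
by rewrite (blocks_coord_eq0 mk ik) (blocks_coord_eq0 nk ik) !(mulr0, mul0r) subrr.
Qed.

(** Subtracting the projection to the first [N k] coordinates does not change [v]. On the span of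
    [y] the same continuous operation kills the first [k] blocks and fixes the others. *)
Lemma clspan_blocks_tail v k : clspan y v ->
  (forall n, (n < N k)%N -> coords e v n = 0) ->
  clspan (fun n => y (k + n)%N) v.
Proof.
move=> yv vk; have -> : v = v - proj e (N k) v by rewrite proj0 ?subr0.
move: v yv {vk}; apply: closure_map.
  by move=> u; apply: cvgB; [exact: cvg_id|exact: proj_continuous].
move=> _ [M [a ->]].
set S := closure _.
have SP (l : nat) : S (y l - proj e (N k) (y l)).
  have [lk|kl] := ltnP l k.
    rewrite proj_id // ?subrr; first exact: clspan0.
    move=> n kn; apply: contraTeq kn => /(let: And3 _ _ h := yN l in h n).
    move=> /andP[_ nl]; rewrite -ltnNge; exact: leq_trans nl (blocks_leq lk).
  rewrite proj0 ?subr0 => [|n nk].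
    by rewrite -(subnKC kl); exact: (@clspan_basis _ _ (fun n => y (k + n)%N) (l - k)).
  apply: contraTeq nk => /(let: And3 _ _ h := yN l in h n) /andP[ln _].
  rewrite -leqNgt; exact: leq_trans (blocks_leq kl) ln.
elim: M => [|M IH].
  rewrite big_ord0 sub0r proj0 ?oppr0; first exact: clspan0.
  by move=> n _; rewrite coords0.
rewrite big_ord_recr /= [X in X - _]addrC [X in proj _ _ X]addrC projP //.
rewrite opprD addrACA -scalerBr.
exact: clspanP (SP M) IH.
Qed.

(** A block basis of [Z] has its terms from index [N k] on supported beyond the first [N k]
    coordinates, so dropping the earlier ones lands in the tail of [y]. *)
Lemma clspan_tail_block Z k : block_subspace e Z -> Z `<=` clspan y ->
  exists W, [/\ block_subspace e W, W `<=` Z & W `<=` clspan (fun n => y (k + n)%N)].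
Proof.
move=> [z bz ->] zy; exists (clspan (fun n => z (N k + n)%N)); split.
- by apply: block_subspace_clspan; exact: block_basis_tail.
- by apply: clspan_subset => n; exact: clspan_basis.
- apply: clspan_subset => n; apply: clspan_blocks_tail.
    by apply: zy; exact: clspan_basis.
  move=> m mk; apply: contraTeq mk => /(block_basis_supp bz) h.
  by rewrite -leqNgt (leq_trans _ h) // leq_addr.
Qed.

End BlocksTheory.
End Blocks.

(** * Diagonal sequences for hereditary dense properties *)

Section Fusion.
Variables (K : numFieldType) (X : normedModType K) (e : nat -> X).
Hypothesis basis_e : is_basis e.
Variables (S : eqType) (Phi : S -> set X -> Prop) (Y : set X).
Hypothesis block_Y : block_subspace e Y.
Hypothesis Phi_hereditary : forall s W Z, W `<=` Z -> Phi s Z -> Phi s W.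
Hypothesis Phi_dense : forall s Z, block_subspace e Z -> Z `<=` Y ->
  exists W, [/\ block_subspace e W, W `<=` Z & Phi s W].

Lemma finite_dense (A : set S) Z : finite_set A ->
  block_subspace e Z -> Z `<=` Y ->
  exists W, [/\ block_subspace e W, W `<=` Z & forall s, A s -> Phi s W].
Proof.
move=> /finite_seqP[l ->]; elim: l Z => [|s l IH] Z bZ ZY; first by exists Z; split.
have [W [bW WZ sW]] := Phi_dense s bZ ZY.
have [V [bV VW lV]] := IH W bW (subset_trans WZ ZY).
exists V; split=> // [|t]; first exact: subset_trans VW WZ.
rewrite /= inE => /orP[/eqP ->|/lV //]; exact: Phi_hereditary VW sW.
Qed.

(** Blocks are picked from a decreasing sequence of subspaces. As soon as the mark [N k] is fixed,
    and before block [k] is picked, the subspace is shrunk finitely often to secure [Phi] for all of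
    [F (N k)]. *)
Lemma fusion (F : nat -> set S) : (forall n, finite_set (F n)) ->
  exists y N, [/\ blocks e y N, N 0%N = 0%N, clspan y `<=` Y
    & forall k s, F (N k) s -> Phi s (clspan (fun n => y (k + n)%N))].
Proof.
move=> finF.
pose stage := {p : set X * nat | [/\ block_subspace e p.1, p.1 `<=` Y
  & forall s, F p.2 s -> Phi s p.1]}.
have step (p : stage) : exists q : X * stage,
    [/\ q.1 != 0, (sval p).1 q.1,
        ((sval p).2 < (sval q.2).2)%N,
        (sval q.2).1 `<=` (sval p).1
      & forall n, coords e q.1 n != 0 -> ((sval p).2 <= n < (sval q.2).2)%N].
  case: p => -[Z n] /= [[x bx ZE] ZY _].
  have [xn0 /finitely_supportedP[M xM] _] := bx n.
  have bZ : block_subspace e Z by exists x.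
  (* The new mark [maxn n.+1 M] exceeds the old one and bounds the support of [x n]; the index [n]
     of that vector keeps its support at or after the old mark. *)
  have [W [bW WZ FW]] := finite_dense (finF (maxn n.+1 M)) bZ ZY.
  have good : [/\ block_subspace e (W, maxn n.+1 M).1, (W, maxn n.+1 M).1 `<=` Y
    & forall s, F (W, maxn n.+1 M).2 s -> Phi s (W, maxn n.+1 M).1].
    by split=> //; exact: subset_trans WZ ZY.
  exists (x n, exist _ (W, maxn n.+1 M) good); split=> //=.
  - by rewrite ZE; exact: clspan_basis.
  - by rewrite leq_max leqnn.
  - move=> m xm; rewrite (block_basis_supp basis_e bx xm) /=.
    by rewrite leq_max (xM _ xm) orbT.
have [W [bW WY FW]] := finite_dense (finF 0%N) block_Y (@subset_refl _ Y).
pose p0 : stage := exist _ (W, 0%N) (And3 bW WY FW).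
have [f fP] := choice step.
pose p k := iter k (fun q => (f q).2) p0.
pose y k := (f (p k)).1.
have sub k l : (k <= l)%N -> (sval (p l)).1 `<=` (sval (p k)).1.
  elim: l => [|l IH]; first by rewrite leqn0 => /eqP ->.
  rewrite leq_eqVlt => /predU1P[-> //|kl]; apply: subset_trans (IH kl).
  by have [] := fP (p l).
have tail_sub k : clspan (fun n => y (k + n)%N) `<=` (sval (p k)).1.
  have [[x _ pE] _ _] := svalP (p k).
  rewrite pE; apply: clspan_subset => n; rewrite /clspan -pE.
  by apply: (@sub k (k + n)%N); rewrite ?leq_addr //; have [] := fP (p (k + n)%N).
exists y, (fun k => (sval (p k)).2); split=> //.
- by move=> k; have [? ? ? ? ?] := fP (p k); split.
- exact: subset_trans (tail_sub 0%N) WY.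
- move=> k s ks; apply: Phi_hereditary (tail_sub k) _.
  by have [_ _] := svalP (p k); exact.
Qed.

End Fusion.

(** * Games on codes and the composition of strategies *)

Section Games.
Variables (K : numFieldType) (X : normedModType K) (e : nat -> X).
Variables (V : set X) (r : X -> nat) (T : set (seq nat)).
Implicit Types (Y Z W : set X) (s : seq nat) (phi : seq X -> set X -> X).

(* The winning condition also demands admissibility, since T only sees codes. *)
Definition wins_from s Y : Prop := exists phi,
  winning_strategy e
    [set u : seq X | (forall x, x \in u -> V x) /\ T (s ++ map r u)] Y phi.

Lemma wins_from_target s Y : T s -> wins_from s Y.
Proof.
(* The target is reached before any move, so any legal strategy will do; 0 lies in every block
   subspace. *)
move=> Ts; exists (fun _ _ => 0); split=> [u Z bZ _|Zs _].
  exact: block_subspace0 bZ.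
by exists 0%N; split=> //=; rewrite cats0.
Qed.

Lemma play_cons phi Zs n : play phi Zs n.+1 =
  phi [::] (Zs 0%N) ::
    play (fun u => phi (phi [::] (Zs 0%N) :: u)) (fun m => Zs m.+1) n.
Proof. by elim: n => // n IH; rewrite [LHS]/= -/(play phi Zs n.+1) IH. Qed.

(** P answers the first subspace with a vector [x] as supplied, then follows a strategy fixed in
    advance for the code of [x]. *)
Lemma wins_from_step s Y :
  (forall Z, block_subspace e Z -> Z `<=` Y ->
     exists x, [/\ Z x, V x & wins_from (rcons s (r x)) Y]) ->
  wins_from s Y.
Proof.
move=> winsY.
have /choice[x xP] Z : exists x, block_subspace e Z -> Z `<=` Y ->
    [/\ Z x, V x & wins_from (rcons s (r x)) Y].
  have [[bZ ZY]|nZ] := pselect (block_subspace e Z /\ Z `<=` Y).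
    by have [x xP] := winsY Z bZ ZY; exists x.
  by exists 0 => bZ ZY; case: nZ.
have /choice[psi psiP] d : exists psi, wins_from (rcons s d) Y ->
    winning_strategy e [set u : seq X | (forall x, x \in u -> V x) /\
      T (rcons s d ++ map r u)] Y psi.
  have [[psi psiP]|nd] := pselect (wins_from (rcons s d) Y).
    by exists psi.
  by exists (fun _ _ => 0) => wd; case: nd.
(* A first vector leading to a state that is not won never comes up in play; the default 0 only
   keeps the strategy legal there. *)
exists (fun u Z => if u is v :: u' then
    if `[< wins_from (rcons s (r v)) Y >] then psi (r v) u' Z else 0
  else x Z); split=> [[|v u] Z bZ ZY|Zs ZsP].
- by have [] := xP Z bZ ZY.
- rewrite /=; case: asboolP => [wv|_]; first by have [h _] := psiP _ wv; exact: h.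
  exact: block_subspace0 bZ.
- have [bZ ZY] := ZsP 0%N; have [_ Vx wx] := xP _ bZ ZY.
  have [_ /(_ (fun m => Zs m.+1))[|n [nV nT]]] := psiP _ wx.
    by move=> n; exact: ZsP.
  exists n.+1; rewrite play_cons /= asboolT //; split=> [v|].
    by rewrite inE => /predU1P[->//|]; exact: nV.
  by move: nT; rewrite cat_rcons.
Qed.

Lemma play_eq phi phi' Zs Zs' n :
  (forall u m, phi u (Zs m) = phi' u (Zs' m)) -> play phi Zs n = play phi' Zs' n.
Proof. by move=> phiE; elim: n => //= n ->; rewrite phiE. Qed.

(* The hypothesis says that Y' is contained in Y up to finitely many blocks. *)
Lemma wins_from_mono s Y Y' :
  (forall Z, block_subspace e Z -> Z `<=` Y' ->
     exists W, [/\ block_subspace e W, W `<=` Z & W `<=` Y]) ->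
  wins_from s Y -> wins_from s Y'.
Proof.
move=> sub [phi [phiY phi_wins]].
(* When S plays [Z], P pretends that S played the smaller subspace [w Z], which is legal in [Y]. *)
have /choice[w wP] Z : exists W, block_subspace e Z -> Z `<=` Y' ->
    [/\ block_subspace e W, W `<=` Z & W `<=` Y].
  have [[bZ ZY]|nZ] := pselect (block_subspace e Z /\ Z `<=` Y').
    by have [W WP] := sub Z bZ ZY; exists W.
  by exists set0 => bZ ZY; case: nZ.
exists (fun u Z => phi u (w Z)); split=> [u Z bZ ZY|Zs ZsP].
  by have [bW WZ WY] := wP Z bZ ZY; apply: WZ; exact: phiY.
have [n nP] : exists n, [set u : seq X | (forall x, x \in u -> V x) /\
    T (s ++ [seq r x | x <- u])] (play phi (w \o Zs) n).
  by apply: phi_wins => n; have [bZ ZY] := ZsP n; have [] := wP _ bZ ZY.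
by exists n; rewrite (@play_eq _ phi _ (w \o Zs)).
Qed.

Lemma wins_from_subset s Y Y' : Y' `<=` Y -> wins_from s Y -> wins_from s Y'.
Proof. by move=> sY; apply: wins_from_mono => Z bZ ZY'; exists Z; split=> // z /ZY' /sY. Qed.

End Games.

(** * Finite partitions of bounded sets of scalars *)

Local Open Scope complex_scope.

(* The radius 2 is the bound on coordinates of vectors of the unit ball. *)
Definition finite_partition (K : numFieldType) : Prop := forall eta : K, 0 < eta ->
  exists (I : finType) (q : K -> I), forall a b,
    `|a| <= 2 -> `|b| <= 2 -> q a = q b -> `|a - b| <= eta.

Lemma finite_partition_real (R : realType) : finite_partition R.
Proof.
(* The shift by 2 moves the values into [[0, 4]], which is cut into intervals of length [eta]. *)
move=> eta eta0; pose q (a : R) := Num.truncn ((a + 2) / eta).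
have q_itv a : `|a| <= 2 -> (q a)%:R <= (a + 2) / eta < (q a).+1%:R.
  rewrite ler_norml => /andP[a2 _]; apply: truncn_itv.
  by rewrite divr_ge0 ?(ltW eta0) //; lra.
exists 'I_(Num.truncn (4 / eta)).+1, (fun a => inord (q a)) => a b a2 b2 qab.
have qle c : `|c| <= 2 -> (q c < (Num.truncn (4 / eta)).+1)%N.
  rewrite ler_norml => /andP[_ c2]; rewrite ltnS; apply: le_truncn.
  by rewrite ler_pM2r ?invr_gt0 //; lra.
have {}qab : q a = q b by have := congr1 val qab; rewrite /= !inordK ?qle.
have /andP[a1 a3] := q_itv _ a2; have /andP[b1 b3] := q_itv _ b2.
rewrite qab in a1 a3.
move: a1 a3 b1 b3; rewrite -[(q b).+1%:R]natr1 !ler_pdivlMr // !ltr_pdivrMr //.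
rewrite !mulrDl mul1r => *; rewrite ler_norml; apply/andP; split; lra.
Qed.

Lemma finite_partition_complex (R : realType) : finite_partition R[i].
Proof.
(* Positivity in [R[i]] forces the imaginary part of [eta] to vanish. Real and imaginary parts are
   then each rounded to within [h / 2]. *)
move=> [h h'] /=; rewrite ltcE /= => /andP[/eqP -> h0].
have h20 : 0 < h / 2 by rewrite divr_gt0.
have [I [q qP]] := finite_partition_real h20.
have norm_le (x y c : R) : (`|x +i* y| <= (c%:C : R[i])) = (Num.sqrt (x ^+ 2 + y ^+ 2) <= c).
  by rewrite normc_def lecR.
have norm_le2 (x y : R) : `|x +i* y| <= (2 : R[i]) -> `|x| <= 2 /\ `|y| <= 2.
  rewrite -[2 : R[i]](rmorph_nat (real_complex R)) norm_le => xy2.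
  rewrite -!sqrtr_sqr; split; apply: le_trans xy2; rewrite ler_wsqrtr //.
    by rewrite lerDl sqr_ge0.
  by rewrite lerDr sqr_ge0.
exists (I * I)%type, (fun z => (q (complex.Re z), q (complex.Im z))).
move=> [a a'] [b b'] /norm_le2[a2 a'2] /norm_le2[b2 b'2] /= [qab qab'].
have ab := qP _ _ a2 b2 qab; have ab' := qP _ _ a'2 b'2 qab'.
rewrite norm_le; apply: (@le_trans _ _ (`|a - b| + `|a' - b'|)); last by lra.
rewrite -[leRHS]ger0_norm ?addr_ge0 // -sqrtr_sqr ler_wsqrtr //.
rewrite [leRHS]sqrrD !real_normK ?num_real // lerD2r lerDl.
by rewrite mulrn_wge0 // mulr_ge0.
Qed.

Lemma finite_partition_scalars (R : realType) (K : numFieldType) :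
  K = R :> numFieldType \/ K = R[i] :> numFieldType -> finite_partition K.
Proof.
by case=> ->; [exact: finite_partition_real|exact: finite_partition_complex].
Qed.

(** * Coding admissible vectors by natural numbers *)

Section Rounding.
Variables (K : numFieldType) (X : normedModType K) (e : nat -> X).
Hypothesis basis_e : is_basis e.
Hypothesis normalized_e : forall n, `|e n| = 1.
Hypothesis monotone_e : monotone_basis e.
Hypothesis partition_K : finite_partition K.

Definition admissible (x : X) : Prop :=
  [/\ x != 0, finitely_supported e x & `|x| <= 1].

Lemma finite_lower_bound (delta : nat -> K) n : (forall i, 0 < delta i) ->
  exists2 d, 0 < d & forall i, (i < n)%N -> d <= delta i.
Proof.
(* No minimum is available, the order of K being partial: take the inverse of
   one plus the sum of the inverses. *)
move=> delta0; have delta0V i : 0 < (delta i)^-1 by rewrite invr_gt0.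
have S0 (P : pred 'I_n) : 0 <= \sum_(i < n | P i) (delta i)^-1.
  by apply: sumr_ge0 => i _; exact: ltW.
exists (1 + \sum_(i < n) (delta i)^-1)^-1.
  by rewrite invr_gt0 ltr_wpDr.
move=> i ni; rewrite -[leRHS]invrK lef_pV2 ?posrE ?ltr_wpDr //.
rewrite (bigD1 (Ordinal ni)) //= addrCA lerDl addr_ge0 //.
Qed.

(** A code does not know the position [i] of its vector in a sequence, but [i] is at most every
    index in the support. The precision can therefore be chosen from the length of the support
    alone, below all [delta i] that may matter. *)
Lemma rounding (delta : nat -> K) : (forall n, 0 < delta n) ->
  exists r : X -> nat,
    (forall N, finite_set (r @` [set x | admissible x /\
        forall n, coords e x n != 0 -> (n < N)%N])) /\
    (forall x y, admissible x -> admissible y -> r x = r y ->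
       supp e x = supp e y /\
       forall i n, coords e x n != 0 -> (i <= n)%N -> `|x - y| <= delta i).
Proof.
move=> delta0.
have /choice[d /all_and2[d0 d_le]] n : exists d, 0 < d /\
    forall i, (i < n)%N -> d <= delta i.
  by have [d ? ?] := finite_lower_bound n delta0; exists d.
have /choice[I IP] n : exists I : finType, exists q : K -> I, forall a b,
    `|a| <= 2 -> `|b| <= 2 -> q a = q b -> `|a - b| <= d n / n.+1%:R.
  by apply: partition_K; rewrite divr_gt0.
have {IP} [q qP] : exists q : forall n, K -> I n, forall n a b,
    `|a| <= 2 -> `|b| <= 2 -> q n a = q n b -> `|a - b| <= d n / n.+1%:R.
  by exists (fun n => sval (cid (IP n))) => n; exact: svalP (cid (IP n)).
(* [len x] is the least bound of the support; minimality gives [len x <= N] for vectors supported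
   below [N], hence finitely many codes. *)
have /choice[len lenP] x : exists m, finitely_supported e x ->
    (forall n, coords e x n != 0 -> (n < m)%N) /\
    (forall M, (forall n, coords e x n != 0 -> (n < M)%N) -> (m <= M)%N).
  have [/finitely_supportedP xM|nx] := pselect (finitely_supported e x); last by exists 0%N.
  have xM' : exists M, `[< forall n, coords e x n != 0 -> (n < M)%N >].
    by case: xM => M xM; exists M; apply/asboolP.
  case: (ex_minnP xM') => m /asboolP xm mM; exists m => _; split=> // M ?.
  by apply: mM; apply/asboolP.
(* The boolean records the support exactly, which the partition cell alone would not. *)
pose code n x : {ffun 'I_n -> bool * I n} :=
  [ffun i : 'I_n => (coords e x i == 0, q n (coords e x i))].
pose C := {n : nat & {ffun 'I_n -> bool * I n}}.
pose r x := pickle (Tagged (fun n => {ffun 'I_n -> bool * I n}) (code (len x) x) : C).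
exists r; split=> [N|x y [_ fx x1] [_ fy y1]].
  pose A := \bigcup_(n in `I_N.+1)
    [set pickle (Tagged (fun n => {ffun 'I_n -> bool * I n}) c : C)
      | c in [set: {ffun 'I_n -> bool * I n}]].
  apply: (@sub_finite_set _ _ A).
    move=> _ [x [[_ fx _] xN] <-]; exists (len x).
      by have [_ ] := lenP x fx; rewrite /= ltnS; exact.
    by exists (code (len x) x).
  by apply: bigcup_finite => // n _; apply: finite_image; exact: finite_finset.
move=> /(pcan_inj pickleK) rxy.
have lenxy : len y = len x by have := congr1 tag rxy.
have [xl _] := lenP x fx; have [yl _] := lenP y fy.
move: rxy; rewrite lenxy => /eqP; rewrite eq_Tagged /= => /eqP /ffunP cxy.
rewrite lenxy in yl.
have cE (i : 'I_(len x)) : (coords e x i == 0) = (coords e y i == 0) /\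
    q (len x) (coords e x i) = q (len x) (coords e y i).
  by have := cxy i; rewrite !ffunE => -[-> ->].
have supp_eq n : (coords e x n == 0) = (coords e y n == 0).
  have [nl|nl] := ltnP n (len x); first by have [] := cE (Ordinal nl).
  have eq0 v : (forall m, coords e v m != 0 -> (m < len x)%N) -> coords e v n == 0.
    by move=> vl; apply: contraTT nl => /vl; rewrite -ltnNge.
  by rewrite !eq0.
split; first by apply/seteqP; split=> n; rewrite /supp /= supp_eq.
move=> i n xn ni; have il : (i < len x)%N := leq_ltn_trans ni (xl _ xn).
apply: le_trans (d_le _ _ il).
have -> : x - y = proj e (len x) (x - y).
  rewrite proj_id // => m xm; rewrite coordsB //.
  have /eqP -> : coords e x m == 0 by apply: contraTT xm => /xl; rewrite -ltnNge.
  have /eqP -> : coords e y m == 0 by apply: contraTT xm => /yl; rewrite -ltnNge.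
  by rewrite subrr.
apply: le_trans (ler_norm_sum _ _ _) _.
(* There are [len x] coordinates, each off by at most [d (len x)] divided by [len x + 1], so the
   total stays below [d (len x)]. *)
apply: (@le_trans _ _ (\sum_(j < len x) d (len x) / (len x).+1%:R)).
  apply: ler_sum => j _; rewrite normrZ normalized_e mulr1 coordsB //.
  have le2 z : `|z| <= 1 -> `|coords e z j| <= 2.
    move=> z1; apply: le_trans (coords_bound normalized_e monotone_e z j) _.
    by rewrite -[leRHS]mulr1 ler_pM2l.
  by apply: qP; rewrite ?le2 //; have [] := cE j.
rewrite sumr_const card_ord -[leLHS]mulr_natr mulrAC ler_pdivrMr //.
by rewrite ler_pM2l // ler_nat.
Qed.

End Rounding.

(** * Finite successive sequences and their position among the blocks *)

Section SuccessiveSequences.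
Variables (K : numFieldType) (X : normedModType K) (e : nat -> X).
Hypothesis basis_e : is_basis e.
Implicit Types (s t : seq X).

Lemma Sigma_f_admissible t x : Sigma_f e t -> x \in t -> admissible e x.
Proof. by move=> [tP _] /(nthP 0)[i it <-]; exact: tP. Qed.

Lemma Sigma_f_precedes t i j : Sigma_f e t -> (j < i)%N -> (i < size t)%N ->
  precedes e t`_j t`_i.
Proof.
move=> [tP tlt]; elim: i => // i IH; rewrite ltnS leq_eqVlt => /predU1P[->|ji] it.
  exact: tlt.
move=> m n jm in1; have [ti0 _ _] := tP _ (ltnW it).
have [p ip] := supp_neq0 basis_e ti0.
exact: ltn_trans (IH ji (ltnW it) _ _ jm ip) (tlt _ it _ _ ip in1).
Qed.

Lemma Sigma_f_take t i : Sigma_f e t -> Sigma_f e (take i t).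
Proof.
move=> [tP tlt]; have sz : (size (take i t) <= size t)%N by rewrite size_take_min geq_minr.
have sz' : (size (take i t) <= i)%N by rewrite size_take_min geq_minl.
split=> j jt.
  rewrite nth_take ?(leq_trans jt) //; apply: tP; exact: leq_trans jt sz.
rewrite !nth_take ?(leq_trans jt) ?(ltnW (leq_trans jt _)) //.
by apply: tlt; exact: leq_trans jt sz.
Qed.

Lemma Sigma_f_supp_ge t i n : Sigma_f e t -> (i < size t)%N ->
  coords e t`_i n != 0 -> (i <= n)%N.
Proof.
move=> st; elim: i n => // i IH n it tn.
have [ti0 _ _] := Sigma_f_admissible st (mem_nth 0 (ltnW it)).
have [m im] := supp_neq0 basis_e ti0.
exact: leq_ltn_trans (IH _ (ltnW it) im) (Sigma_f_precedes st (ltnSn i) it im tn).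
Qed.

(** The support of the last term starts at [size t - 1] or later and ends before [N]. *)
Lemma Sigma_f_size t N : Sigma_f e t ->
  (forall x, x \in t -> forall n, coords e x n != 0 -> (n < N)%N) -> (size t <= N)%N.
Proof.
move=> st tN; case: (posnP (size t)) => [->//|t0].
have last_lt : ((size t).-1 < size t)%N by rewrite prednK.
have t_last := mem_nth 0 last_lt; have [tl0 _ _] := Sigma_f_admissible st t_last.
have [m tm] := supp_neq0 basis_e tl0.
rewrite -(prednK t0).
exact: leq_ltn_trans (Sigma_f_supp_ge st last_lt tm) (tN _ t_last _ tm).
Qed.

Hypothesis normalized_e : forall n, `|e n| = 1.
Hypothesis monotone_e : monotone_basis e.

(** The preceding term may end at [M] inside a block [k], but the next term is then zero on all of
    that block: there it is a multiple of [y k], it vanishes at [M], and [y k] does not. So it lies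
    in the tail from [k + 1], whose mark is past the earlier supports. *)
Lemma Sigma_f_next_tail y N t i : blocks e y N -> N 0%N = 0%N ->
  Sigma_f e t -> (forall x, x \in t -> clspan y x) -> (i < size t)%N ->
  exists k, (forall x, x \in take i t -> forall n, coords e x n != 0 -> (n < N k)%N) /\
    clspan (fun n => y (k + n)%N) t`_i.
Proof.
move=> yN N0 st ty; case: i => [|i] it.
  by exists 0%N; split=> [x|]; [rewrite take0|apply: ty; exact: mem_nth].
have it' := ltnW it; have [ti0 /finitely_supportedP[B tB] _] :=
  Sigma_f_admissible st (mem_nth 0 it').
have [M tiM Mmax] := ex_maxnP (supp_neq0 basis_e ti0) (fun n tn => ltnW (tB n tn)).
have exk : exists k, (M < N k)%N by exists M.+1; exact: blocks_ge.
(* The first mark past [M] is not [N 0 = 0], so it has the form [N k.+1] and [M] lies in block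
   [k]. *)
have [[|k] Mk kmin] := ex_minnP exk; first by rewrite N0 in Mk.
have kM : (N k <= M)%N by rewrite leqNgt; apply/negP => /kmin; rewrite ltnn.
exists k.+1; split=> [x|].
  move=> /(nthP 0)[j]; rewrite size_takel // => ji; rewrite nth_take // => <- n jn.
  move: ji; rewrite ltnS leq_eqVlt => /predU1P[ji|ji].
    by rewrite ji in jn; exact: leq_ltn_trans (Mmax _ jn) Mk.
  exact: ltn_trans (Sigma_f_precedes st ji it' jn tiM) Mk.
have tS := ty _ (mem_nth 0 it); have ti := ty _ (mem_nth 0 it').
have tS0 n : (n <= M)%N -> coords e t`_i.+1 n = 0.
  move=> nM; apply: contraTeq nM => tn; rewrite -ltnNge.
  exact: Sigma_f_precedes st (ltnSn i) it _ _ tiM tn.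
apply: (clspan_blocks_tail basis_e yN monotone_e tS) => n nk.
have [/tS0//|Mn] := leqP n M.
have nB : (N k <= n < N k.+1)%N by rewrite nk (leq_trans kM (ltnW Mn)).
have MB : (N k <= M < N k.+1)%N by rewrite kM.
have relate := clspan_blocks_coords basis_e yN normalized_e monotone_e.
have [yk0 _ yk] := yN k; have [m ym] := supp_neq0 basis_e yk0.
(* The preceding term is also a multiple of [y k] on this block and is nonzero at [M]. *)
have yM : coords e (y k) M != 0.
  have := relate _ _ _ _ ti MB (yk _ ym); apply: contra_eq_neq => ->.
  by rewrite mulr0 mulf_neq0.
have /esym/eqP := relate _ _ _ _ tS MB nB.
by rewrite (tS0 M) // mul0r mulf_eq0 (negPf yM) orbF => /eqP.
Qed.

End SuccessiveSequences.

(** * Won and lost states: the two diagonal arguments *)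

Section Dichotomy.
Variables (K : numFieldType) (X : normedModType K) (e : nat -> X).
Hypothesis basis_e : is_basis e.
Hypothesis normalized_e : forall n, `|e n| = 1.
Hypothesis monotone_e : monotone_basis e.
Variables (r : X -> nat) (T : set (seq nat)).
Hypothesis finite_r : forall N, finite_set (r @` [set x | admissible e x /\
  forall n, coords e x n != 0 -> (n < N)%N]).

Local Notation wins := (wins_from e (admissible e) r T).

(** Both the length of such a sequence and the set of possible codes of its terms are bounded in
    terms of [N]. *)
Lemma finite_codes N : finite_set [set map r t | t in
  [set t | Sigma_f e t /\
     forall x, x \in t -> forall n, coords e x n != 0 -> (n < N)%N]].
Proof.
set A := r @` [set x | admissible e x /\ forall n, coords e x n != 0 -> (n < N)%N].
apply: (@sub_finite_set _ _ [set u : seq nat | (size u <= N)%N /\ forall d, d \in u -> A d]).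
  move=> _ [t [st tN] <-]; split; first by rewrite size_map; exact: (Sigma_f_size basis_e).
  move=> _ /mapP[x xt ->]; exists x => //; split; last exact: tN.
  exact: Sigma_f_admissible xt.
elim: {1}N => [|n IH].
  apply: sub_finite_set (finite_set1 [::]) => u [].
  by rewrite leqn0 size_eq0 => /eqP.
apply: (@sub_finite_set _ _ ([set [::]] `|`
    [set d :: u | d in A & u in [set u : seq nat | (size u <= n)%N /\ forall d, d \in u -> A d]])).
  move=> [|d u] [un uA]; [by left|right].
  exists d; first by apply: uA; rewrite mem_head.
  by exists u => //; split=> // d' d'u; apply: uA; rewrite inE d'u orbT.
by rewrite finite_setU; split; [exact: finite_set1|apply: finite_image2 => //; exact: finite_r].
Qed.

Lemma decided_subspace : exists Y, block_subspace e Y /\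
  forall s, wins s Y \/ forall W, block_subspace e W -> W `<=` Y -> ~ wins s W.
Proof.
pose Phi s Z := wins s Z \/ forall W, block_subspace e W -> W `<=` Z -> ~ wins s W.
have [|s Z bZ ZY|n|y [N [yN _ _ yP]]] := @fusion _ _ e basis_e _ Phi (clspan e)
  (block_subspace_clspan (block_basis_e basis_e)) _ _ (fun n => [set s | (pickle s < n)%N]).
- move=> s W Z WZ [wZ|lZ]; [left; exact: wins_from_subset wZ|right=> V bV VW].
  by apply: lZ => //; exact: subset_trans VW WZ.
- have [[W [bW WZ wW]]|nW] := pselect (exists W, [/\ block_subspace e W, W `<=` Z & wins s W]).
    by exists W; split=> //; left.
  by exists Z; split=> //; right=> W bW WZ wW; apply: nW; exists W.
- apply: (@sub_finite_set _ _ (pickle @^-1` `I_n)) => //.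
  apply: finite_preimage => // u v _ _; exact: (pcan_inj pickleK).
exists (clspan y); split.
  by apply: block_subspace_clspan; exact: (block_basis_blocks yN).
(* Since [N k >= k], the tail from [(pickle s).+1] decides [s]. The decision passes to the whole of
   [clspan y] because every block subspace of it contains one inside that tail. *)
move=> s; have [|wins_tail|lose_tail] := yP (pickle s).+1 s.
- by rewrite /=; exact: (blocks_ge yN).
- left; apply: wins_from_mono wins_tail => Z bZ Zy.
  exact: (clspan_tail_block basis_e yN monotone_e _ bZ Zy).
- right=> W bW Wy wW.
  have [V [bV VW Vy]] := clspan_tail_block basis_e yN monotone_e (pickle s).+1 bW Wy.
  exact: lose_tail bV Vy (wins_from_subset VW wW).
Qed.

Lemma target_dichotomy : exists Y, block_subspace e Y /\
  (wins [::] Y \/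
   forall t, Sigma_f e t -> (forall x, x \in t -> Y x) -> ~ T (map r t)).
Proof.
have [Y [bY decY]] := decided_subspace.
have [wY|nY] := pselect (wins [::] Y); first by exists Y; split=> //; left.
pose Phi s Z := wins s Y \/
  forall x, Z x -> admissible e x -> ~ wins (rcons s (r x)) Y.
have [|s Z bZ ZY||y [N [yN N0 yY yP]]] := @fusion _ _ e basis_e _ Phi Y bY _ _
  (fun n => [set map r t | t in [set t | Sigma_f e t /\
     forall x, x \in t -> forall n', coords e x n' != 0 -> (n' < n)%N]]).
- by move=> s W Z WZ [|lZ]; [left|right=> x /WZ; exact: lZ].
- have [wY|lY] := decY s; first by exists Z; split=> //; left.
  (* If no [W] inside [Z] avoided all winning continuations, P could move to a won state from every
     such [W], and so would win from [s] on [Z]. *)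
  apply: contrapT => nW; apply: (lY Z bZ ZY); apply: wins_from_step => W bW WZ.
  apply: contrapT => nx; apply: nW; exists W; split=> //; right=> x Wx ax wx.
  by apply: nx; exists x; split=> //; exact: wins_from_subset wx.
- exact: finite_codes.
exists (clspan y); split.
  by apply: block_subspace_clspan; exact: (block_basis_blocks yN).
right=> t st ty.
(* Lostness propagates along [t]: the state of each prefix was treated before the tail containing
   the next term, so that term leads to a lost state again. *)
have lose i : (i <= size t)%N -> ~ wins (map r (take i t)) Y.
  elim: i => [|i IH] it; first by rewrite take0.
  have [k [tk tik]] := Sigma_f_next_tail basis_e normalized_e monotone_e yN N0 st ty it.
  rewrite (take_nth 0) // map_rcons.
  have [||] := yP k (map r (take i t)).
  - by exists (take i t) => //; split=> //; exact: Sigma_f_take.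
  - by move=> wi; case: (IH (ltnW it)).
  - move=> lose; apply: lose tik _; apply: Sigma_f_admissible st _; exact: mem_nth.
move=> Tt; apply: (lose _ (leqnn _)); apply: wins_from_target => //.
by rewrite take_size.
Qed.

End Dichotomy.

(** * From codes back to vectors of the enlargement *)

Unset Implicit Arguments.

Theorem theorem2p1 (R : realType) (K : numFieldType)
    (scalars : K = R :> numFieldType \/ K = R[i] :> numFieldType)
    (X : completeNormedModType K) (e : nat -> X)
    (basis_e : is_basis e)
    (normalized_e : forall n, `|e n| = 1)
    (monotone_e : monotone_basis e)
    (sigma : set (seq X)) (sigma_sub : sigma `<=` Sigma_f e)
    (delta : nat -> K) (delta_gt0 : forall n, 0 < delta n) :
  exists Y : set X, block_subspace e Y /\
    ((forall s, sigma s -> ~ (forall v, v \in s -> Y v)) \/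
     exists phi : seq X -> set X -> X,
       winning_strategy e (enlargement e sigma delta) Y phi).
Proof.
have [r [finite_r r_eq]] := rounding basis_e normalized_e monotone_e
  (finite_partition_scalars scalars) delta_gt0.
have [Y [bY [[phi [phiY phi_wins]]|lose]]] :=
    target_dichotomy basis_e normalized_e monotone_e [set map r t | t in sigma] finite_r.
  exists Y; split=> //; right; exists phi; split=> // Zs ZsP.
  have [n [ua [t sigma_t rtu]]] := phi_wins Zs ZsP; exists n.
  move: (play _ _ _) ua rtu => u ua /= rtu.
  have st := sigma_sub _ sigma_t.
  have size_tu : size t = size u by rewrite -(size_map r t) rtu size_map.
  have aut i : (i < size u)%N -> [/\ admissible e u`_i, admissible e t`_i & r t`_i = r u`_i].
    move=> iu; split; first by apply: ua; exact: mem_nth.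
      by apply: (Sigma_f_admissible st); rewrite mem_nth ?size_tu.
    by rewrite -!(nth_map 0 0%N) ?size_tu // rtu.
  (* Equal codes mean equal supports, so the vectors played are successive because the terms of [t]
     are. *)
  split.
    split=> [i iu|i iu]; first by have [] := aut i iu.
    have [a1 a2 r12] := aut _ (ltnW iu); have [b1 b2 s12] := aut _ iu.
    have [su _] := r_eq _ _ a2 a1 r12; have [sv _] := r_eq _ _ b2 b1 s12.
    by rewrite /precedes -su -sv; apply: (proj2 st); rewrite size_tu.
  exists t; split=> // i iu; have [au at' rt] := aut i iu.
  have [_ dist] := r_eq _ _ at' au rt.
  have [ti0 _ _] := at'; have [n' tn] := supp_neq0 basis_e ti0.
  have ti : (i < size t)%N by rewrite size_tu.
  (* The support of the term at position [i] starts at [i] or later, so equality of codes gives the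
     distance [delta i]. *)
  exact: dist tn (Sigma_f_supp_ge basis_e st ti tn).
by exists Y; split=> //; left=> t sigma_t tY; apply: (lose t) => //; [exact: sigma_sub|exists t].
Qed.
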